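(* Let $d\ge1$, $N\ge 2$, let $z^1,\ldots,z^N\in\mathbb{R}^d$ be points with $$\Delta=\min_{j,k\in\{1,\ldots,N\},\,j\neq k}\|z^j-z^k\|_\infty>0,$$ and let $z^{desi,1},\ldots,z^{desi,N}\in\mathbb{R}^d$ be desired data values. Let $\lambda\in(0,1)$ and $\mu=\frac1\lambda$ be given, and for $\gamma_1,\gamma_2>0$ let $$h_1=\lambda\,\Delta\,\gamma_1\ge\frac d2,\qquad h_2=\frac{d}{d+1}\left(1-\frac{d}{\cosh(2\lambda\Delta\gamma_1)}\right)\gamma_2 .$$ Let $\varepsilon\in(0,1)$ be given. Let $\gamma_1$ and $\gamma_2$ be chosen sufficiently large such that for $$\kappa(\gamma_1)=\frac{d+1}{d}\,\frac{1}{1-\frac{d}{\cosh(2\lambda\Delta\gamma_1)}}\left[1-4\exp(-2(\mu-1)\lambda\Delta\gamma_1)\right]-1$$ we have $\kappa(\gamma_1)>0$ and $$4(N-1)\exp\left(-2\,\kappa(\gamma_1)\,\frac{d}{d+1}\left(1-\frac{d}{\cosh(2\lambda\Delta\gamma_1)}\right)\gamma_2\right)<1-\varepsilon .$$ Then the problem of neural interpolation has a solution, that is, there exist $w^1,\ldots,w^N\in\mathbb{R}^d$ such that for all $k\in\{1,\ldots,N\}$ $$\sum_{j=1}^N G_0(z^k,z^j)\,w^j=z^{desi,k}.$$ Moreover, for any norm $\|\cdot\|$ on the finite-dimensional space that contains the parameters $(W,h_1,h_2,\gamma_1,\gamma_2)$ there exists a constant $C_N$, not depending on the desired values $z^{desi,1},\ldots,z^{desi,N}$,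 such that we can find a solution of the interpolation problem that satisfies the a priori bound $$\|(W,h_1,h_2,\gamma_1,\gamma_2)\|\le C_N\Big(1+\max_{j\in\{1,\ldots,N\}}\|z^{desi,j}\|_\infty\Big),$$ where $W$ is the $d\times N$ matrix with the columns $w^1,\ldots,w^N$.
   Context: For $h>0$ and $x\in\mathbb{R}$ let $g_0(x,h)=\frac{\tanh(x+h)-\tanh(x-h)}{2\tanh(h)}$. For parameters $\gamma_1,\gamma_2,h_1,h_2>0$ and $y,z\in\mathbb{R}^d$ let $$G_0(y,z)=g_0\Big(\gamma_2\Big(\sum_{i=1}^d g_0(\gamma_1(y_i-z_i),h_1)-d\Big),\,h_2\Big).$$ $\|z\|_\infty=\max_{i}|z_i|$ is the maximum norm on $\mathbb{R}^d$. *)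

(* Defs.v *)
From mathcomp Require Import all_boot all_order all_algebra.
From mathcomp Require Import all_classical all_reals all_analysis.

Set Implicit Arguments.
Unset Strict Implicit.
Unset Printing Implicit Defensive.

Import Order.TTheory GRing.Theory Num.Theory.
Import numFieldNormedType.Exports.

Local Open Scope classical_set_scope.
Local Open Scope ring_scope.

(* Points of R^d are column vectors 'cV[R]_d; the library norm `|x| on them is
   the maximum norm. *)

Definition cosh {R : realType} (x : R) : R := (expR x + expR (- x)) / 2.

Definition tanh {R : realType} (x : R) : R :=
  (expR x - expR (- x)) / (expR x + expR (- x)).

Definition g0 {R : realType} (x h : R) : R :=
  (tanh (x + h) - tanh (x - h)) / (2 * tanh h).

Definition G0 {R : realType} {d : nat} (gamma1 gamma2 h1 h2 : R)
    (y z : 'cV[R]_d) : R :=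
  g0 (gamma2 * (\sum_(i < d) g0 (gamma1 * (y i 0 - z i 0)) h1 - d%:R)) h2.

Definition is_minimum {R : realType} (A : set R) (m : R) : Prop :=
  A m /\ lbound A m.

Definition pairwise_distances {R : realType} {d N : nat}
    (z : 'I_N -> 'cV[R]_d) : set R :=
  [set r | exists j k : 'I_N, j != k /\ r = `|z j - z k|].

(* The common factor 1 - d / cosh (2 lambda Delta gamma1) of h2, kappa and the
   smallness condition. *)
Definition cosh_factor {R : realType} (d : nat) (lambda Delta gamma1 : R) : R :=
  1 - d%:R / cosh (2 * lambda * Delta * gamma1).

Definition kappa {R : realType} (d : nat) (lambda mu Delta gamma1 : R) : R :=
  (d%:R + 1) / d%:R * (1 / cosh_factor d lambda Delta gamma1)
  * (1 - 4 * expR (- 2 * (mu - 1) * lambda * Delta * gamma1)) - 1.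

Definition interpolates {R : realType} {d N : nat} (gamma1 gamma2 h1 h2 : R)
    (z zdesi : 'I_N -> 'cV[R]_d) (w : 'I_N -> 'cV[R]_d) : Prop :=
  forall k : 'I_N,
    \sum_(j < N) G0 gamma1 gamma2 h1 h2 (z k) (z j) *: w j = zdesi k.

(* The space of the parameters (W, h1, h2, gamma1, gamma2); R^o is R as a module
   over itself. *)
Definition parameter_space (R : realType) (d N : nat) : lmodType R :=
  ('M[R]_(d, N) * R^o * R^o * R^o * R^o)%type.

(* An arbitrary norm on V, as opposed to the canonical norm `|_|.
   Nonnegativity follows from the three fields. *)
Record is_norm {R : realType} {V : lmodType R} (nrm : V -> R) : Prop := IsNorm {
  is_norm_triangle : forall x y : V, nrm (x + y) <= nrm x + nrm y;
  is_norm_scale : forall (a : R) (x : V), nrm (a *: x) = `|a| * nrm x;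
  is_norm_definite : forall x : V, nrm x = 0 -> x = 0
}.

(* Main.v *)
Require Import Defs.
From mathcomp Require Import all_boot all_order all_algebra.
From mathcomp Require Import all_classical all_reals all_analysis.
From mathcomp Require Import ring lra.

Import Order.TTheory GRing.Theory Num.Theory.
Import numFieldNormedType.Exports.

Local Open Scope classical_set_scope.
Local Open Scope ring_scope.

(** The interpolation conditions are a linear system W M = Z, where Z has the
    desired values as columns and M j k = G0 (z k) (z j).  The reason why M is
    invertible is that G0 behaves like a smoothed indicator of a cube: it is 1
    on the diagonal and exponentially small at distance Delta, so M is strictly
    diagonally dominant ([col_diag_dominant_unitmx]).

    Smallness off the diagonal comes from applying one estimate twice, namely
    g0 x h <= 4 exp (-2 (|x| - h)) ([g0_decay]).  In the inner layer, two
    points at distance at least Delta differ by at least Delta in some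
    coordinate; the corresponding summand is at most
    4 exp (-2 (gamma1 Delta - h1)) and the other d - 1 summands are at most 1,
    so the sum stays below d by a definite amount.  In the outer layer this gap
    is multiplied by gamma2, and kappa is defined precisely so that the result
    exceeds h2 by kappa h2.  Hence every off-diagonal entry is at most
    4 exp (-2 kappa h2), and N - 1 of them add up to less than 1.

    For the a priori bound, W = Z M^-1 depends linearly on the data.  An
    arbitrary norm of the parameters is at most the sum of |W i j| times the
    norms of the coordinate vectors ([parameters_sum_delta]), plus the norm of
    the fixed part (0, h1, h2, gamma1, gamma2); the entries |W i j| are at most
    the column sums of |M^-1| times the largest norm of a desired value. *)

(** * Hyperbolic functions and the single-layer bump g0 *)

Lemma cosh_ge1 {R : realType} (x : R) : 1 <= Defs.cosh x.
Proof.
have x0 := expR_gt0 x.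
rewrite /Defs.cosh expRN ler_pdivlMr // mul1r -subr_ge0.
have -> : expR x + (expR x)^-1 - 2 = (expR x - 1) ^+ 2 / expR x.
  by field; rewrite gt_eqF.
by rewrite divr_ge0 ?sqr_ge0 // ltW.
Qed.

(** With the assumption d / 2 <= h1 this gives d < cosh (2 h1), which makes the
    factor 1 - d / cosh (2 h1), and with it h2, positive. *)
Lemma cosh_gt_id {R : realType} (x : R) : x < Defs.cosh x.
Proof.
(* exp x = e exp (x - 1) >= 2 x whenever x is nonnegative, as e >= 2. *)
have h1 := expR_ge1Dx (1 : R); have h2 := expR_ge1Dx (x - 1).
have h3 := expR_gt0 (- x); have h4 := expR_gt0 x.
have E : expR x = expR 1 * expR (x - 1) by rewrite -expRD; congr expR; ring.
have := expR_gt0 (x - 1).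
rewrite /Defs.cosh; nra.
Qed.

Lemma cosh_ge_expR_norm {R : realType} (x : R) :
  expR `|x| / 2 <= Defs.cosh x.
Proof.
have hx := expR_gt0 x; have hn := expR_gt0 (- x).
rewrite /Defs.cosh ler_pM2r ?invr_gt0 //.
by case: (ger0P x) => _; rewrite ?lerDl ?lerDr ltW.
Qed.

(** All bounds on g0 are read off from this quotient: the difference of the two
    tanh terms is sinh (2 h) / (cosh (x + h) cosh (x - h)), and dividing by
    2 tanh h leaves cosh h ^ 2 in the numerator. *)
Lemma g0E {R : realType} (x h : R) : 0 < h ->
  g0 x h = (Defs.cosh (2 * h) + 1) / (Defs.cosh (2 * x) + Defs.cosh (2 * h)).
Proof.
move=> h0.
have H1 : 1 < expR h by rewrite expR_gt1.
have X0 := expR_gt0 x.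
have H0 := expR_gt0 h.
have E2 y : expR (2 * y) = expR y ^+ 2 :> R by rewrite expr2 -expRD; congr expR; ring.
rewrite /g0 /Defs.tanh /Defs.cosh !expRN !E2 !expRD !expRN.
move: (expR x) (expR h) H1 X0 H0 => X H H1 X0 H0.
have p1 : 0 < X ^+ 2 by rewrite exprn_gt0.
have p2 : 0 < H ^+ 2 by rewrite exprn_gt0.
have p3 : 1 < H ^+ 2 by rewrite expr2; nra.
have q1 : 0 < X * X by rewrite mulr_gt0.
have q2 : 1 < H * H by nra.
have q3 : 0 < (X * H) * (X * H) by rewrite !mulr_gt0.
have q4 : 0 < ((X * X) ^+ 2 + 1) * H ^+ 2 + ((H * H) ^+ 2 + 1) * X ^+ 2.
  by rewrite addr_gt0 // mulr_gt0 // ltr_wpDl // sqr_ge0.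
by field; rewrite !gt_eqF //; lra.
Qed.

Lemma g00 {R : realType} (h : R) : 0 < h -> g0 0 h = 1.
Proof.
move=> h0; rewrite g0E // mulr0.
have -> : Defs.cosh 0 = 1 :> R by rewrite /Defs.cosh oppr0 expR0; field.
by rewrite [1 + _]addrC divff // gt_eqF //; have := cosh_ge1 (2 * h); lra.
Qed.

Lemma g0_ge0 {R : realType} (x h : R) : 0 < h -> 0 <= g0 x h.
Proof.
move=> h0; have c1 := cosh_ge1 (2 * x); have c2 := cosh_ge1 (2 * h).
by rewrite g0E // divr_ge0 //; lra.
Qed.

Lemma g0_le1 {R : realType} (x h : R) : 0 < h -> g0 x h <= 1.
Proof.
move=> h0; have c1 := cosh_ge1 (2 * x); have c2 := cosh_ge1 (2 * h).
by rewrite g0E // ler_pdivrMr ?mul1r; lra.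
Qed.

(** The numerator is at most 2 exp (2 h) and the denominator at least
    exp (2 |x|) / 2. *)
Lemma g0_decay {R : realType} (x h : R) : 0 < h ->
  g0 x h <= 4 * expR (- 2 * (`|x| - h)).
Proof.
move=> h0; have c1 := cosh_ge1 (2 * x); have c2 := cosh_ge1 (2 * h).
rewrite g0E // ler_pdivrMr; last by lra.
have -> : - 2 * (`|x| - h) = 2 * h - `|2 * x| by rewrite normrM ger0_norm //; ring.
rewrite expRD expRN.
have a0 := expR_gt0 `|2 * x|; have := cosh_ge_expR_norm (2 * x).
set a := expR `|2 * x| in a0 *; set b := expR (2 * h).
have b1 : 1 <= b by rewrite -expR0 ler_expR mulr_ge0 // ltW.
have hb : Defs.cosh (2 * h) + 1 <= 2 * b.
  have : expR (- (2 * h)) <= 1 by rewrite -expR0 ler_expR oppr_le0 mulr_ge0 // ltW.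
  by rewrite /Defs.cosh -/b; lra.
move=> ha; apply: (le_trans hb).
have -> : 2 * b = 4 * (b / a) * (a / 2) by field; rewrite gt_eqF.
rewrite ler_pM2l; last by rewrite mulr_gt0 // divr_gt0 // (lt_le_trans _ b1).
by lra.
Qed.

(** * The two-layer bump G0 *)

Lemma mx_norm_attained {R : realType} {d : nat} (x : 'cV[R]_d) :
  `|x| != 0 -> exists i, `|x| = `|x i 0|.
Proof.
by case/mx_norm_neq0 => -[i j]; rewrite [j]ord1 => e; exists i.
Qed.

Lemma ler_mx_norm_entry {R : realType} {d : nat} (x : 'cV[R]_d) i : `|x i 0| <= `|x|.
Proof.
rewrite [leRHS]/Num.norm/= mx_normrE.
exact: (le_bigmax (0 : R) (fun ij : 'I_d * 'I_1 => `|x ij.1 ij.2|) (i, 0)).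
Qed.

Lemma G0_diag {R : realType} {d : nat} (gamma1 gamma2 h1 h2 : R) (y : 'cV[R]_d) :
  0 < h1 -> 0 < h2 -> G0 gamma1 gamma2 h1 h2 y y = 1.
Proof.
move=> h10 h20; rewrite /G0 (eq_bigr (fun=> 1)) => [|i _].
  by rewrite sumr_const card_ord subrr mulr0 g00.
by rewrite subrr mulr0 g00.
Qed.

(** One coordinate in which y and z are r apart already pushes the inner sum at
    least 1 - 4 exp (-2 (gamma1 r - h1)) below d; the outer bump turns this
    gap, scaled by gamma2, into exponential decay. *)
Lemma G0_decay {R : realType} {d : nat} {gamma1 gamma2 h1 h2 r : R}
    {y z : 'cV[R]_d} :
  0 < gamma1 -> 0 < gamma2 -> 0 < h1 -> 0 < h2 -> 0 < r -> r <= `|y - z| ->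
  G0 gamma1 gamma2 h1 h2 y z <=
  4 * expR (- 2 * (gamma2 * (1 - 4 * expR (- 2 * (gamma1 * r - h1))) - h2)).
Proof.
move=> g10 g20 h10 h20 r0 hr.
have [i ei] : exists i, `|y - z| = `|(y - z) i 0|.
  by apply: mx_norm_attained; rewrite gt_eqF // (lt_le_trans r0).
apply: (le_trans (g0_decay _ _ h20)).
rewrite ler_pM2l // ler_expR ler_nM2l ?oppr_lt0 // lerD2r.
rewrite normrM (gtr0_norm g20) ler_pM2l // -normrN opprB.
apply: le_trans (ler_norm _).
have -> : d%:R - \sum_(i < d) g0 (gamma1 * (y i 0 - z i 0)) h1 =
    \sum_(i < d) (1 - g0 (gamma1 * (y i 0 - z i 0)) h1).
  by rewrite sumrB sumr_const card_ord.
rewrite (bigD1 i) //= -[leLHS]addr0 lerD //; last first.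
  by rewrite sumr_ge0 // => j _; rewrite subr_ge0 g0_le1.
rewrite lerD2l lerN2 (le_trans (g0_decay _ _ h10)) //.
rewrite ler_pM2l // ler_expR ler_nM2l ?oppr_lt0 // lerD2r.
rewrite normrM (gtr0_norm g10) ler_pM2l //.
by rewrite (le_trans hr) // ei !mxE.
Qed.

(** * Diagonal dominance and the interpolation matrix *)

(** A left kernel vector v would violate dominance in the column k where |v k|
    is largest: the diagonal term of (v A) k is too big to be cancelled. *)
Lemma col_diag_dominant_unitmx {R : realFieldType} {n : nat} (A : 'M[R]_n) :
  (forall k, \sum_(j < n | j != k) `|A j k| < `|A k k|) -> A \in unitmx.
Proof.
move=> dom; rewrite unitmxE unitfE; apply/det0P => -[v v0 vA].
have [l vl] : exists l, v 0 l != 0.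
  by apply/existsP; apply: contraR v0 => /existsPn v0; apply/eqP/rowP => i;
    rewrite mxE; apply/eqP/negPn/v0.
pose k := [arg max_(i > l) `|v 0 i|]%O.
have kmax j : `|v 0 j| <= `|v 0 k|.
  by rewrite /k; case: arg_maxP => //= i _; apply.
have vk : 0 < `|v 0 k| by apply: lt_le_trans (kmax l); rewrite normr_gt0.
have /rowP/(_ k) := vA; rewrite !mxE (bigD1 k) //= => /eqP.
rewrite addr_eq0 => /eqP/(congr1 Num.norm); rewrite normrN normrM => e.
have : `|v 0 k| * `|A k k| <= `|v 0 k| * \sum_(j < n | j != k) `|A j k|.
  rewrite e (le_trans (ler_norm_sum _ _ _)) // mulr_sumr ler_sum // => j _.
  by rewrite normrM ler_wpM2r.
by rewrite ler_pM2l // leNgt dom.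
Qed.

Lemma near_identity_unitmx {R : realFieldType} {n : nat} (A : 'M[R]_n) (b : R) :
  (forall k, A k k = 1) -> (forall j k, j != k -> `|A j k| <= b) ->
  (n%:R - 1) * b < 1 -> A \in unitmx.
Proof.
move=> diag off small; apply: col_diag_dominant_unitmx => k.
rewrite diag normr1; apply: le_lt_trans small.
apply: (@le_trans _ _ (\sum_(j < n | j != k) b)).
  by apply: ler_sum => j; apply: off.
have n1 : (0 < n)%N by apply: leq_ltn_trans (ltn_ord k).
rewrite sumr_const cardC1 card_ord -[leLHS]mulr_natl.
suff -> : n.-1%:R = n%:R - 1 :> R by [].
by apply/eqP; rewrite eq_sym subr_eq natr1 prednK.
Qed.

(** The transposed indexing turns the unknown coefficient vectors into the
    columns of W in W M = Z. *)
Definition interpolation_mx {R : realType} {d N : nat} (gamma1 gamma2 h1 h2 : R)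
    (z : 'I_N -> 'cV[R]_d) : 'M[R]_N :=
  \matrix_(j, k) G0 gamma1 gamma2 h1 h2 (z k) (z j).

Definition interpolation_solution {R : realType} {d N : nat}
    (gamma1 gamma2 h1 h2 : R) (z zdesi : 'I_N -> 'cV[R]_d) : 'M[R]_(d, N) :=
  (\matrix_(i, k) zdesi k i 0) *m invmx (interpolation_mx gamma1 gamma2 h1 h2 z).

Lemma interpolation_solutionP {R : realType} {d N : nat}
    (gamma1 gamma2 h1 h2 : R) (z zdesi : 'I_N -> 'cV[R]_d) :
  interpolation_mx gamma1 gamma2 h1 h2 z \in unitmx ->
  interpolates gamma1 gamma2 h1 h2 z zdesi
    (fun j => col j (interpolation_solution gamma1 gamma2 h1 h2 z zdesi)).
Proof.
move=> MU k; apply/colP => i.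
have /matrixP/(_ i k) := mulmxKV MU (\matrix_(i, k) zdesi k i 0).
rewrite [X in _ = X -> _]mxE => <-; rewrite summxE mxE.
by apply: eq_bigr => j _; rewrite !mxE mulrC.
Qed.

Lemma interpolation_solution_entry_le {R : realType} {d N : nat}
    (gamma1 gamma2 h1 h2 : R) (z zdesi : 'I_N -> 'cV[R]_d) i j (m : R) :
  (forall k, `|zdesi k| <= m) ->
  `|interpolation_solution gamma1 gamma2 h1 h2 z zdesi i j| <=
    (\sum_k `|invmx (interpolation_mx gamma1 gamma2 h1 h2 z) k j|) * m.
Proof.
move=> hm; rewrite mxE (le_trans (ler_norm_sum _ _ _)) // mulr_suml.
apply: ler_sum => k _; rewrite normrM mulrC ler_wpM2l // mxE.
exact: le_trans (ler_mx_norm_entry _ _) (hm k).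
Qed.

(** * Arbitrary norms on the parameter space *)

Lemma is_norm0 {R : realType} {V : lmodType R} {nrm : V -> R}
    (hn : is_norm nrm) : nrm 0 = 0.
Proof. by rewrite -(scale0r (0 : V)) (is_norm_scale hn) normr0 mul0r. Qed.

Lemma is_norm_ge0 {R : realType} {V : lmodType R} {nrm : V -> R}
    (hn : is_norm nrm) x : 0 <= nrm x.
Proof.
have := is_norm_triangle hn x (- x).
rewrite subrr (is_norm0 hn) -[- x]scaleN1r (is_norm_scale hn) normrN1 mul1r.
by lra.
Qed.

Lemma is_norm_sum {R : realType} {V : lmodType R} {nrm : V -> R}
    (hn : is_norm nrm) (I : Type) (r : seq I) (F : I -> V) :
  nrm (\sum_(i <- r) F i) <= \sum_(i <- r) nrm (F i).
Proof.
elim/big_rec2: _ => [|i x y _ h]; first by rewrite (is_norm0 hn).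
by rewrite (le_trans (is_norm_triangle hn _ _)) // lerD2l.
Qed.

Lemma parameters_sum_delta {R : realType} {d N : nat} (W : 'M[R]_(d, N))
    (h1 h2 gamma1 gamma2 : R) :
  (W, h1, h2, gamma1, gamma2) =
  \sum_i \sum_j W i j *: (delta_mx i j, 0, 0, 0, 0)
    + (0, h1, h2, gamma1, gamma2) :> parameter_space R d N.
Proof.
pose iota (A : 'M[R]_(d, N)) : parameter_space R d N := (A, 0, 0, 0, 0).
have iotaD : {morph iota : A B / A + B}.
  by move=> A B; rewrite /iota; congr (_, _, _, _, _); rewrite addr0.
have iotaZ a A : iota (a *: A) = a *: iota A.
  by rewrite /iota; congr (_, _, _, _, _); rewrite scaler0.
transitivity (iota W + (0, h1, h2, gamma1, gamma2)).
  by rewrite /iota; congr (_, _, _, _, _); rewrite ?addr0 ?add0r.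
congr (_ + _); rewrite [in LHS](matrix_sum_delta W).
rewrite (big_morph iota iotaD (erefl _)).
apply: eq_bigr => i _; rewrite (big_morph iota iotaD (erefl _)).
by apply: eq_bigr => j _; rewrite iotaZ.
Qed.

Theorem theorem2 (R : realType) (d N : nat) (hd : (1 <= d)%N) (hN : (2 <= N)%N)
    (z : 'I_N -> 'cV[R]_d) (Delta : R)
    (hDelta_min : is_minimum (pairwise_distances z) Delta)
    (hDelta_gt0 : 0 < Delta)
    (lambda mu : R) (hlambda : 0 < lambda < 1) (hmu : mu = 1 / lambda)
    (gamma1 gamma2 : R) (hgamma1 : 0 < gamma1) (hgamma2 : 0 < gamma2)
    (h1 h2 : R)
    (hh1 : h1 = lambda * Delta * gamma1) (hh1_ge : d%:R / 2 <= h1)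
    (hh2 : h2 = d%:R / (d%:R + 1) * cosh_factor d lambda Delta gamma1 * gamma2)
    (eps : R) (heps : 0 < eps < 1)
    (hkappa : 0 < kappa d lambda mu Delta gamma1)
    (hsmall : 4 * (N%:R - 1)
        * expR (- 2 * kappa d lambda mu Delta gamma1 * (d%:R / (d%:R + 1))
                * cosh_factor d lambda Delta gamma1 * gamma2) < 1 - eps) :
  (forall zdesi : 'I_N -> 'cV[R]_d,
     exists w : 'I_N -> 'cV[R]_d, interpolates gamma1 gamma2 h1 h2 z zdesi w)
  /\
  (forall nrm : parameter_space R d N -> R, is_norm nrm ->
     exists C : R, forall zdesi : 'I_N -> 'cV[R]_d,
       exists W : 'M[R]_(d, N),
         interpolates gamma1 gamma2 h1 h2 z zdesi (fun j => col j W) /\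
         nrm (W, h1, h2, gamma1, gamma2)
           <= C * (1 + \big[Num.max/0]_(j < N) `|zdesi j|)).
Proof.
have d0 : 0 < d%:R :> R by rewrite ltr0n.
have h10 : 0 < h1 by lra.
have cf0 : 0 < cosh_factor d lambda Delta gamma1.
  rewrite /cosh_factor subr_gt0 ltr_pdivrMr ?mul1r.
    by apply: le_lt_trans (cosh_gt_id _); rewrite -!mulrA mulrA; lra.
  by apply: lt_le_trans (cosh_ge1 _).
have h20 : 0 < h2 by rewrite hh2 !mulr_gt0 ?invr_gt0 // addr_gt0.
have l0 : 0 < lambda by case/andP: hlambda.
(* The definition of kappa, solved for the margin by which the outer argument
   exceeds h2; mu = 1 / lambda turns (mu - 1) lambda into 1 - lambda. *)
have kappa_h2 : gamma2 * (1 - 4 * expR (- 2 * (gamma1 * Delta - h1))) - h2 =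
    kappa d lambda mu Delta gamma1 * h2.
  have -> : - 2 * (gamma1 * Delta - h1) =
      - 2 * (mu - 1) * lambda * Delta * gamma1.
    by rewrite hh1 hmu; field; rewrite gt_eqF.
  rewrite /kappa hh2; field.
  by rewrite !gt_eqF // addr_gt0.
have MU : interpolation_mx gamma1 gamma2 h1 h2 z \in unitmx.
  apply: (near_identity_unitmx _
    (4 * expR (- 2 * (kappa d lambda mu Delta gamma1 * h2)))).
  - by move=> k; rewrite mxE G0_diag.
  - move=> j k jk; rewrite mxE ger0_norm ?g0_ge0 //.
    have far : Delta <= `|z k - z j|.
      by apply: hDelta_min.2; exists k, j; rewrite eq_sym.
    rewrite -kappa_h2.
    exact: (G0_decay hgamma1 hgamma2 h10 h20 hDelta_gt0 far).
  - have -> : - 2 * (kappa d lambda mu Delta gamma1 * h2) =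
        - 2 * kappa d lambda mu Delta gamma1 * (d%:R / (d%:R + 1))
          * cosh_factor d lambda Delta gamma1 * gamma2 by rewrite hh2; ring.
    by lra.
pose sol zdesi := interpolation_solution gamma1 gamma2 h1 h2 z zdesi.
split=> [zdesi|nrm hnrm].
  by exists (fun j => col j (sol zdesi)); apply: interpolation_solutionP.
pose E i j : parameter_space R d N := (delta_mx i j, 0, 0, 0, 0).
pose c : parameter_space R d N := (0, h1, h2, gamma1, gamma2).
pose K j := \sum_k `|invmx (interpolation_mx gamma1 gamma2 h1 h2 z) k j|.
exists (\sum_i \sum_j K j * nrm (E i j) + nrm c) => zdesi.
exists (sol zdesi); split; first exact: interpolation_solutionP.
set m := \big[Num.max/0]_(_ < _) _.
have m0 : 0 <= m by rewrite /m bigmax_idl le_max lexx.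
have zm k : `|zdesi k| <= m by apply: (le_bigmax 0 (fun k => `|zdesi k|)).
rewrite parameters_sum_delta (le_trans (is_norm_triangle hnrm _ _)) // mulrDl.
have nrm_ge0 := is_norm_ge0 hnrm.
apply: lerD; last by rewrite mulrDr mulr1 lerDl mulr_ge0.
rewrite (le_trans (is_norm_sum hnrm _ _ _)) // mulr_suml ler_sum // => i _.
rewrite (le_trans (is_norm_sum hnrm _ _ _)) // mulr_suml ler_sum // => j _.
rewrite (is_norm_scale hnrm) mulrAC ler_wpM2r //.
apply: (le_trans (interpolation_solution_entry_le _ _ _ _ _ _ _ _ _ zm)).
by rewrite ler_wpM2l ?lerDr // sumr_ge0.
Qed.
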